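(* Let $\sigma,\tau\in\mathcal{P}$ with $\sigma\le\tau$ and $|\tau|-|\sigma|\ge 3$. Then the interval $[\sigma,\tau]$ is disconnected if and only if $\sigma$ straddles $\tau$.
   Context: $\mathcal{S}_n$ is the set of permutations of $\{1,\dots,n\}$ in one-line notation $\tau=\tau_1\tau_2\dots\tau_n$, with $|\tau|=n$. The reduction of a sequence of $k$ distinct positive integers is the permutation in $\mathcal{S}_k$ obtained by replacing the smallest entry by $1$, the second smallest by $2$, and so on. For $1\le i\le j\le n$, $\tau_{[i,j]}\in\mathcal{S}_{j-i+1}$ is the reduction of $\tau_i\dots\tau_j$. The consecutive pattern poset $\mathcal{P}$ is the set $\bigcup_{n\ge1}\mathcal{S}_n$ with $\sigma\le\tau$ iff $\sigma=\tau_{[i,j]}$ for some $i\le j$; then $\tau_i\dots\tau_j$ is called an occurrence of $\sigma$ in $\tau$. Permutation $\sigma$ is a prefix (resp. suffix) of $\tau\in\mathcal{S}_n$ if $\sigma=\tau_{[1,i]}$ (resp. $\sigma=\tau_{[n-i+1,n]}$) for some $i$. For $\sigma\le\tau$, $[\sigma,\tau]=\{\pi:\sigma\le\pi\le\tau\}$ and $(\sigma,\tau)=\{\pi:\sigma<\pi<\tau\}$. The interval $[\sigma,\tau]$ is disconnected if its order complex (the simplicial complex whose faces are the chains of $(\sigma,\tau)$) is disconnected; equivalently, if the Hasse diagram of the open interval $(\sigma,\tau)$ is a disconnected graph. For $\sigma<\tau$, $\sigma$ straddles $\tau$ if $\sigma$ is both a prefix and a suffix of $\tau$ and has no other occurrences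 in $\tau$. *)

(* Defs.v *)
From HB Require Import structures.
From mathcomp Require Import all_boot all_order.
From mathcomp Require Import finmap.

Set Implicit Arguments.
Unset Strict Implicit.
Unset Printing Implicit Defensive.

Import Order.Theory.

(* One-line notation, with the letters of a permutation of size n taken in
   {1, ..., n}. *)
Definition is_perm_word (w : seq nat) : bool :=
  (0 < size w) && perm_eq w (iota 1 (size w)).

(* The disjoint union of the symmetric groups S_n, n >= 1. *)
Record cperm := CPerm { word :> seq nat; _ : is_perm_word word }.

HB.instance Definition _ := [isSub for word].
HB.instance Definition _ := [Countable of cperm by <:].

Definition reduction (w : seq nat) : seq nat :=
  [seq (index x (sort leq w)).+1 | x <- w].

(* [factor w i j] is w_i ... w_j; positions are numbered from 1. *)
Definition factor (w : seq nat) (i j : nat) : seq nat := drop i.-1 (take j w).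

Definition occurs_at (s t : cperm) (i j : nat) : bool :=
  [&& 1 <= i, i <= j, j <= size t & word s == reduction (factor t i j)].

Definition cpat_le (s t : cperm) : bool :=
  [exists i : 'I_(size t).+1, exists j : 'I_(size t).+1, occurs_at s t i j].

Lemma cpat_leP (s t : cperm) :
  reflect (exists i j, occurs_at s t i j) (cpat_le s t).
Proof.
apply: (iffP existsP) => [[i /existsP[j st]]|[i [j /and4P[i1 ij jt st]]]].
  by exists i, j.
have it : i < (size t).+1 by rewrite ltnS (leq_trans ij).
exists (Ordinal it); apply/existsP; exists (Ordinal (jt : j < (size t).+1)).
exact/and4P.
Qed.

Lemma index_sorted_ltn (x : nat) (s : seq nat) :
  sorted ltn s -> x \in s -> index x s = count (fun y => y < x) s.
Proof.
elim: s => //= y s IH sy; rewrite inE.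
have ay : all (ltn y) s := order_path_min ltn_trans sy.
have [-> _|_ /= xs] := eqVneq x y.
  rewrite ltnn add0n; apply/esym/eqP; rewrite -leqn0 leqNgt -has_count.
  apply/hasPn => z zs; rewrite -leqNgt ltnW //; exact: (allP ay).
have ltyx : y < x := allP ay _ xs.
by rewrite ltyx (IH (path_sorted sy) xs).
Qed.

Lemma reductionE (w : seq nat) : uniq w ->
  reduction w = [seq (count (fun y => y < x) w).+1 | x <- w].
Proof.
move=> uw; apply/eq_in_map => x xw; congr _.+1.
rewrite index_sorted_ltn ?mem_sort ?count_sort //.
by rewrite ltn_sorted_uniq_leq sort_uniq uw sort_sorted //; exact: leq_total.
Qed.

Lemma size_reduction (w : seq nat) : size (reduction w) = size w.
Proof. exact: size_map. Qed.

Lemma reduction_mono (f : nat -> nat) (w : seq nat) : uniq w ->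
  {in w &, {mono f : x y / x < y}} -> reduction (map f w) = reduction w.
Proof.
move=> uw fm.
have fi : {in w &, injective f}.
  move=> x y xw yw fxy; have := fm _ _ xw yw; have := fm _ _ yw xw.
  by rewrite fxy ltnn; case: (ltngtP x y).
rewrite !reductionE ?map_inj_in_uniq // -map_comp.
apply/eq_in_map => x xw /=; congr _.+1; rewrite count_map.
by apply: eq_in_count => y yw /=; rewrite fm.
Qed.

Lemma count_ltn_mono (w : seq nat) :
  {in w &, {mono (fun x => (count (fun y => y < x) w).+1) : x y / x < y}}.
Proof.
move=> x y xw yw /=; rewrite ltnS; case: (ltnP x y) => [xy|yx]; last first.
  apply/negbTE; rewrite -leqNgt.
  by apply: sub_count => z zy; exact: leq_trans zy yx.
have le_count v : count (fun z => z < x) v <= count (fun z => z < y) v.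
  by apply: sub_count => z zx; exact: ltn_trans zx xy.
elim: w xw {yw} => //= z w IH; rewrite inE => /orP[/eqP<-|xw].
  by rewrite ltnn xy add0n add1n ltnS le_count.
rewrite -addnS leq_add ?IH //.
by case zx: (z < x); rewrite // (ltn_trans zx xy).
Qed.

Lemma reduction_factor (w : seq nat) (i j : nat) : uniq w ->
  reduction (factor (reduction w) i j) = reduction (factor w i j).
Proof.
move=> uw; rewrite [X in factor X]reductionE // /factor -map_take -map_drop.
rewrite reduction_mono //; first by rewrite drop_uniq ?take_uniq.
by move=> x y /mem_drop/mem_take xw /mem_drop/mem_take yw; exact: count_ltn_mono.
Qed.

Lemma reduction_perm_word (w : seq nat) : uniq w -> 0 < size w ->
  is_perm_word (reduction w).
Proof.
move=> uw w0; rewrite /is_perm_word size_reduction w0 /=.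
have ur : uniq (reduction w).
  rewrite reductionE // map_inj_in_uniq // => x y xw yw.
  have := count_ltn_mono xw yw; have := count_ltn_mono yw xw.
  by case: (ltngtP x y) => // _ + + e; rewrite e ltnn.
have rw : {subset reduction w <= iota 1 (size w)}.
  move=> _ /mapP[x xw ->]; rewrite mem_iota add1n !ltnS /=.
  by rewrite -[X in _ < X](size_sort leq) index_mem mem_sort.
apply: uniq_perm => //; first exact: iota_uniq.
have sz : size (iota 1 (size w)) <= size (reduction w).
  by rewrite size_reduction size_iota.
by have [] := uniq_min_size ur rw sz.
Qed.

Lemma cperm_uniq (t : cperm) : uniq t.
Proof. by case: t => w /= /andP[_ /perm_uniq->]; exact: iota_uniq. Qed.

Lemma cperm_size_gt0 (t : cperm) : 0 < size t.
Proof. by case: t => w /= /andP[]. Qed.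

Lemma reduction_cperm (t : cperm) : reduction t = t.
Proof.
case: t => w /= /andP[_ pw].
have sw : sort leq w = iota 1 (size w).
  apply: (sorted_eq leq_trans anti_leq).
  - exact/sort_sorted/leq_total.
  - exact: iota_sorted.
  - by rewrite perm_sort.
rewrite /reduction sw -[RHS]map_id; apply/eq_in_map => x.
rewrite (perm_mem pw) mem_iota; case: x => // x /andP[_ xs]; congr _.+1.
have <- : nth 0 (iota 1 (size w)) x = x.+1 by rewrite nth_iota.
by rewrite index_uniq ?size_iota ?iota_uniq.
Qed.

Lemma size_factor (w : seq nat) (i j : nat) : j <= size w ->
  size (factor w i j) = j - i.-1.
Proof. by move=> jw; rewrite size_drop size_takel. Qed.

Lemma factor_factor (w : seq nat) (i j k l : nat) :
  1 <= i -> 1 <= k -> i.-1 + l <= j ->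
  factor (factor w i j) k l = factor w (i.-1 + k) (i.-1 + l).
Proof.
case: i k => [//|i] [//|k] _ _ /= lj; rewrite /factor /=.
by rewrite take_drop take_takel ?drop_drop ?addnS ?[l + _]addnC //= addnC.
Qed.

Lemma cpat_le_refl : reflexive cpat_le.
Proof.
move=> t; apply/cpat_leP; exists 1, (size t); rewrite /occurs_at !leqnn.
by rewrite cperm_size_gt0 /factor drop0 take_size reduction_cperm eqxx.
Qed.

Lemma occurs_at_size (s t : cperm) (i j : nat) :
  occurs_at s t i j -> size s = j - i.-1.
Proof.
by case/and4P=> _ _ jt /eqP->; rewrite size_reduction size_factor.
Qed.

Lemma cpat_le_anti : antisymmetric cpat_le.
Proof.
move=> s t /andP[/cpat_leP[i [j st]] /cpat_leP[k [l ts]]].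
have zs := occurs_at_size st; have zt := occurs_at_size ts.
have /and4P[i1 ij jt /eqP es] := st; have /and4P[k1 kl ls _] := ts.
have s_t : size s <= size t by rewrite zs (leq_trans (leq_subr _ _)).
have t_s : size t <= size s by rewrite zt (leq_trans (leq_subr _ _)).
have jE : j = size t.
  by apply/eqP; rewrite eqn_leq jt (leq_trans t_s) // zs leq_subr.
have iE : i.-1 = 0.
  apply/eqP; rewrite -leqn0 leqNgt; apply/negP => i0; move: t_s.
  by rewrite zs jE leqNgt ltn_subrL i0 cperm_size_gt0.
apply: val_inj; rewrite /= es /factor iE jE drop0 take_size.
exact: reduction_cperm.
Qed.

Lemma cpat_le_trans : transitive cpat_le.
Proof.
move=> t s u /cpat_leP[k [l st]] /cpat_leP[i [j tu]]; apply/cpat_leP.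
have zt := occurs_at_size tu.
have /and4P[k1 kl lt /eqP es] := st; have /and4P[i1 ij ju /eqP et] := tu.
have lj : i.-1 + l <= j.
  by rewrite -leq_subRL ?(leq_trans (leq_pred _)) // -zt.
exists (i.-1 + k), (i.-1 + l); apply/and4P; split.
- by rewrite (leq_trans k1) ?leq_addl.
- by rewrite leq_add2l.
- exact: leq_trans lj ju.
- rewrite es et reduction_factor; first by rewrite factor_factor.
  by rewrite drop_uniq ?take_uniq ?cperm_uniq.
Qed.

Fact cperm_display : Order.disp_t. Proof. exact: Order.Disp tt tt. Qed.

HB.instance Definition _ := Order.Le_isPOrder.Build cperm_display cperm
  cpat_le_refl cpat_le_anti cpat_le_trans.

Definition is_prefix (s t : cperm) : Prop := exists i, occurs_at s t 1 i.

Definition is_suffix (s t : cperm) : Prop :=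
  exists i, 1 <= i <= size t /\ occurs_at s t (size t - i + 1) (size t).

Definition straddles (s t : cperm) : Prop :=
  [/\ (s < t)%O, is_prefix s t, is_suffix s t &
      forall i j, occurs_at s t i j -> i = 1 \/ j = size t].

Definition open_interval (s t : cperm) : {pred cperm} :=
  [pred x | (s < x < t)%O].

Section SimplicialComplexes.
Local Open Scope fset_scope.

(* A simplicial complex is given by the set of its faces; its vertices are the
   [v] such that [fset v] is a face. *)
Definition vertex (V : choiceType) (K : {pred {fset V}}) (v : V) : bool :=
  [fset v] \in K.

Definition edge (V : choiceType) (K : {pred {fset V}}) : rel V :=
  fun u v => [fset u; v] \in K.

(* The path components of a simplicial complex are those of its 1-skeleton. *)
Definition complex_disconnected (V : choiceType) (K : {pred {fset V}}) : Prop :=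
  exists u v, [/\ vertex K u, vertex K v &
    forall p : seq V, path (edge K) u p -> last u p != v].

(* The faces are the finite chains of A, the empty one included. *)
Definition order_complex (d : Order.disp_t) (T : porderType d)
    (A : {pred T}) : {pred {fset T}} :=
  [pred F : {fset T} | all (mem A) (enum_fset F) &&
    all2rel (fun x y => (x >=< y)%O) (enum_fset F)].

End SimplicialComplexes.

Definition interval_disconnected (s t : cperm) : Prop :=
  complex_disconnected (order_complex (open_interval s t)).

(* Main.v *)
Require Import Defs.
From mathcomp Require Import all_boot all_order.
From mathcomp Require Import finmap zify.

(** Write n and m for the sizes of tau and sigma. The permutations below tau
    are the patterns of its windows [i, j], and every one of them other than
    tau lies below p = tau_[1, n-1] or q = tau_[2, n]. Both p and q lie above
    r = tau_[2, n-1].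

    If the open interval is disconnected, then sigma <= p, since otherwise all
    its elements lie below q, which then joins any two of them; likewise
    sigma <= q. Also sigma is not below r: as n - m >= 3, r would be an element
    of the open interval, and any two elements would be joined through p or q,
    then r, then p or q. Thus sigma has an occurrence in [1, n-1], one in
    [2, n] and none in [2, n-1], which forces them to be a prefix and a suffix
    of tau, and says that there are no others.

    Conversely, if sigma straddles tau, then a window whose pattern lies in the
    open interval contains the first or the last m positions, so that pattern is
    a prefix or a suffix of tau. A prefix and a suffix in the interval are never
    comparable ([straddles_incomparable]): the smaller one would occur away from
    its own end of tau, and would carry a copy of sigma to a place where sigma
    does not occur. Hence no path leads from p to q. *)

Set Implicit Arguments.
Unset Strict Implicit.
Unset Printing Implicit Defensive.

Import Order.Theory.

(** The pattern tau_[i, j]. The default value [t] is only taken when [i, j] is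
    not a window of [t]. *)
Definition window (t : cperm) (i j : nat) : cperm :=
  insubd t (reduction (factor t i j)).

Lemma word_window (t : cperm) i j : 1 <= i -> i <= j -> j <= size t ->
  word (window t i j) = reduction (factor t i j).
Proof.
move=> i1 ij jt; rewrite /window -[LHS]/(val _) insubdK //.
apply: reduction_perm_word; first by rewrite drop_uniq ?take_uniq ?cperm_uniq.
by rewrite size_factor //; lia.
Qed.

Lemma occurs_atE (s t : cperm) i j :
  occurs_at s t i j = [&& 1 <= i, i <= j, j <= size t & s == window t i j].
Proof.
apply/and4P/and4P => -[i1 ij jt /eqP st]; split=> //; apply/eqP.
  by apply: val_inj; rewrite /= word_window.
by rewrite st word_window.
Qed.

Lemma window_window (t : cperm) i j k l :
  1 <= i -> j <= size t -> 1 <= k -> k <= l -> i.-1 + l <= j ->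
  window (window t i j) k l = window t (i.-1 + k) (i.-1 + l).
Proof.
move=> i1 jt k1 kl lj; have ij : i <= j by lia.
apply: val_inj; rewrite /= !word_window ?size_reduction ?size_factor //; try lia.
rewrite reduction_factor ?drop_uniq ?take_uniq ?cperm_uniq //.
by rewrite factor_factor.
Qed.

Lemma window_full (t : cperm) : window t 1 (size t) = t.
Proof.
apply: val_inj; rewrite /= word_window ?cperm_size_gt0 //.
by rewrite /factor drop0 take_size reduction_cperm.
Qed.

Lemma occurs_at_window (t : cperm) i j : 1 <= i -> i <= j -> j <= size t ->
  occurs_at (window t i j) t i j.
Proof. by move=> i1 ij jt; rewrite occurs_atE i1 ij jt eqxx. Qed.

Lemma occurs_at_le (s t : cperm) i j : occurs_at s t i j -> (s <= t)%O.
Proof. by move=> st; apply/cpat_leP; exists i, j. Qed.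

(** Occurrences in the pattern of a window are the occurrences inside that
    window, so that comparisons between windows of [t] can be read in [t]. *)
Lemma le_occurs_atP (s x t : cperm) i j : occurs_at x t i j ->
  reflect (exists k l, [/\ i <= k, l <= j & occurs_at s t k l]) (s <= x)%O.
Proof.
move=> xt; have zx := occurs_at_size xt.
move: xt; rewrite occurs_atE => /and4P[i1 ij jt /eqP xE].
apply: (iffP (cpat_leP s x)) => -[k [l]].
  rewrite occurs_atE => /and4P[k1 kl lx /eqP->].
  exists (i.-1 + k), (i.-1 + l).
  rewrite occurs_atE xE window_window ?eqxx //; last by lia.
  by split; lia.
case=> ik lj; rewrite occurs_atE => /and4P[k1 kl lt /eqP->].
exists (k - i.-1), (l - i.-1); rewrite occurs_atE xE window_window //; try lia.
have -> : i.-1 + (k - i.-1) = k by lia.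
have -> : i.-1 + (l - i.-1) = l by lia.
by rewrite -xE zx eqxx; lia.
Qed.

(** Two windows with the same pattern [x] have the same patterns at
    corresponding places. *)
Lemma occurs_at_shift (s x t : cperm) i j k l a b :
  occurs_at x t i j -> occurs_at x t k l ->
  occurs_at s t a b -> i <= a -> b <= j ->
  occurs_at s t (k + (a - i)) (k + (b - i)).
Proof.
move=> xi xk; have := occurs_at_size xi; have := occurs_at_size xk.
move: xi xk; rewrite !occurs_atE.
move=> /and4P[i1 ij jt /eqP xi] /and4P[k1 kl lt /eqP xk] zk zi.
move=> /and4P[a1 ab bt /eqP sE] ia bj.
have /esym : s = window x (a - i).+1 (b - i).+1.
  by rewrite sE xi window_window //; try lia; congr window; lia.
rewrite xk window_window //; try lia.
have -> : k.-1 + (a - i).+1 = k + (a - i) by lia.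
have -> : k.-1 + (b - i).+1 = k + (b - i) by lia.
by move=> ->; rewrite eqxx; lia.
Qed.

Lemma cperm_ltE (s t : cperm) : (s < t)%O = (s <= t)%O && (size s < size t).
Proof.
apply/idP/andP => [st|[st zst]]; last first.
  by rewrite lt_neqAle st andbT; apply/eqP => e; rewrite e ltnn in zst.
have le_st := ltW st; split=> //.
have /cpat_leP[i [j o]] := le_st.
have zs := occurs_at_size o; move: o; rewrite occurs_atE.
move=> /and4P[i1 ij jt /eqP sE]; rewrite ltnNge; apply/negP => ts.
have [e1 e2] : i = 1 /\ j = size t by lia.
by move: st; rewrite sE e1 e2 window_full ltxx.
Qed.

Lemma is_suffixP (s t : cperm) :
  is_suffix s t <-> exists a, occurs_at s t a (size t).
Proof.
split=> [[i [_ o]]|[a o]]; first by exists (size t - i + 1).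
have /and4P[a1 at_ _ _] := o.
exists (size t - a + 1); split; first by lia.
by have -> : size t - (size t - a + 1) + 1 = a by lia.
Qed.

Lemma edge_order_complex d (T : porderType d) (A : {pred T}) (x y : T) :
  edge (order_complex A) x y = [&& x \in A, y \in A & (x >=< y)%O].
Proof.
apply/andP/and3P => [[/allP sA /allrelP cA]|[xA yA xy]].
  have xF : x \in enum_fset [fset x; y]%fset by rewrite fset21.
  have yF : y \in enum_fset [fset x; y]%fset by rewrite fset22.
  by split; [exact: sA | exact: sA | exact: cA].
split; first by apply/allP => z; rewrite in_fset2 => /orP[] /eqP->.
apply/allrelP => z w; rewrite !in_fset2 => /orP[] /eqP-> /orP[] /eqP->;
  by rewrite ?comparablexx // comparable_sym.
Qed.

Lemma vertex_order_complex d (T : porderType d) (A : {pred T}) (x : T) :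
  vertex (order_complex A) x = (x \in A).
Proof.
have := edge_order_complex A x x.
by rewrite /edge fsetUid comparablexx andbT andbb.
Qed.

(** A strictly smaller pattern misses the first or the last letter. *)
Lemma lt_maximal_window (x t : cperm) : 1 < size t -> (x < t)%O ->
  (x <= window t 1 (size t).-1)%O \/ (x <= window t 2 (size t))%O.
Proof.
move=> t1; rewrite cperm_ltE => /andP[/cpat_leP[i [j o]] zxt].
have zx := occurs_at_size o; have /and4P[i1 ij jt _] := o.
have [i2|i_le1] := leqP 2 i; [right|left].
  by apply/(le_occurs_atP _ (occurs_at_window _ _ _)); try lia; exists i, j.
by apply/(le_occurs_atP _ (occurs_at_window _ _ _)); try lia;
   exists i, j; split=> //; lia.
Qed.

Section Straddling.
Variables (s t : cperm).
Hypothesis st : straddles s t.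

Lemma straddles_prefix_or_suffix (x : cperm) :
  x \in open_interval s t -> is_prefix x t \/ is_suffix x t.
Proof.
case: st => _ _ _ only_ends /andP[/ltW sx /ltW/cpat_leP[k [l o]]].
have /and4P[k1 _ lt _] := o.
have /(le_occurs_atP _ o)[i [j [ki jl /only_ends[i1|jt]]]] := sx.
  by left; exists l; have <- : k = 1 by lia.
by right; apply/is_suffixP; exists k; have <- : l = size t by lia.
Qed.

(** Whichever of the two patterns is smaller occurs both at its own end of [t]
    and inside the larger one, hence away from that end. The copy of [s] at the
    end of [t] is moved along, and lands on a window touching neither end,
    because the moved pattern is longer than [s]. *)
Lemma straddles_incomparable (x y : cperm) :
  x \in open_interval s t -> y \in open_interval s t ->
  is_prefix x t -> is_suffix y t -> (x >=< y)%O = false.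
Proof.
case: st => _ [m sp] /is_suffixP[a ss] only_ends.
rewrite !inE !cperm_ltE.
move=> /andP[/andP[_ sx] /andP[_ xt]] /andP[/andP[_ sy] /andP[_ yt]].
move=> [b xp] /is_suffixP[c ys].
have := occurs_at_size sp; have := occurs_at_size ss.
have := occurs_at_size xp; have := occurs_at_size ys.
have /and4P[_ m1 mt _] := sp; have /and4P[a1 at_ _ _] := ss.
have /and4P[_ b1 bt _] := xp; have /and4P[c1 ct _ _] := ys.
move=> zy zx zs' zs.
apply/negP => /orP[/(le_occurs_atP _ ys)|/(le_occurs_atP _ xp)] [k [l [ck lb o]]];
  have zo := occurs_at_size o; have /and4P[k1 kl lt _] := o.
  have mb : m <= b by lia.
  by have [] := only_ends _ _ (occurs_at_shift xp o sp (leqnn _) mb); lia.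
have ca : c <= a by lia.
by have [] := only_ends _ _ (occurs_at_shift ys o ss ca (leqnn _)); lia.
Qed.

(** A step of a path from a prefix cannot reach a suffix, so it reaches another
    prefix: the prefixes are a union of path components. *)
Lemma straddles_path_prefix (x : cperm) (p : seq cperm) :
  x \in open_interval s t -> is_prefix x t ->
  path (edge (order_complex (open_interval s t))) x p ->
  last x p \in open_interval s t /\ is_prefix (last x p) t.
Proof.
elim: p x => //= y p IH x xI xp /andP[]; rewrite edge_order_complex.
move=> /and3P[_ yI xy]; apply: IH => //.
have [//|ys] := straddles_prefix_or_suffix yI.
by rewrite straddles_incomparable in xy.
Qed.

Lemma straddles_disconnected :
  2 <= size t - size s -> interval_disconnected s t.
Proof.
move=> zst; case: (st) => _ [m sp] /is_suffixP[a ss] _.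
have s0 := cperm_size_gt0 s.
have := occurs_at_size sp; have := occurs_at_size ss.
have /and4P[_ m1 mt _] := sp; have /and4P[a1 at_ _ _] := ss => zs' zs.
have po : occurs_at (window t 1 (size t).-1) t 1 (size t).-1.
  by apply: occurs_at_window; lia.
have qo : occurs_at (window t 2 (size t)) t 2 (size t).
  by apply: occurs_at_window; lia.
have zp := occurs_at_size po; have zq := occurs_at_size qo.
have pI : window t 1 (size t).-1 \in open_interval s t.
  rewrite inE !cperm_ltE (occurs_at_le po) zp.
  rewrite (introT (le_occurs_atP _ po)); first by lia.
  by exists 1, m; split=> //; lia.
have qI : window t 2 (size t) \in open_interval s t.
  rewrite inE !cperm_ltE (occurs_at_le qo) zq.
  rewrite (introT (le_occurs_atP _ qo)); first by lia.
  by exists a, (size t); split=> //; lia.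
exists (window t 1 (size t).-1), (window t 2 (size t)).
rewrite !vertex_order_complex; split=> // w pw.
have pp : is_prefix (window t 1 (size t).-1) t by exists (size t).-1.
have [_ lp] := straddles_path_prefix pI pp pw.
apply/eqP => lq; rewrite lq in lp.
have qs : is_suffix (window t 2 (size t)) t by apply/is_suffixP; exists 2.
by have := straddles_incomparable qI qI lp qs; rewrite comparablexx.
Qed.

End Straddling.

(** An occurrence of [s] that touches neither end of [t] would lie inside
    [2, size t - 1]. So the occurrence in the first window is at the start of
    [t], and the one in the second window is at its end. *)
Lemma straddles_from_windows (s t : cperm) : 2 < size t -> size s < size t ->
  (s <= window t 1 (size t).-1)%O -> (s <= window t 2 (size t))%O ->
  ~ (s <= window t 2 (size t).-1)%O -> straddles s t.
Proof.
move=> t2 zst sp sq sr.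
have po : occurs_at (window t 1 (size t).-1) t 1 (size t).-1.
  by apply: occurs_at_window; lia.
have qo : occurs_at (window t 2 (size t)) t 2 (size t).
  by apply: occurs_at_window; lia.
have ro : occurs_at (window t 2 (size t).-1) t 2 (size t).-1.
  by apply: occurs_at_window; lia.
have only_ends i j : occurs_at s t i j -> i = 1 \/ j = size t.
  move=> o; have /and4P[i1 ij jt _] := o.
  have [i_le1|i2] := leqP i 1; first by left; lia.
  have [tj|jt1] := leqP (size t) j; first by right; lia.
  by case: sr; apply/(le_occurs_atP _ ro); exists i, j; split=> //; lia.
split=> //; first by rewrite cperm_ltE zst (le_trans sp (occurs_at_le po)).
  have /(le_occurs_atP _ po)[i [j [_ jt o]]] := sp.
  by exists j; have [<-|jE] := only_ends _ _ o; last lia.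
apply/is_suffixP; have /(le_occurs_atP _ qo)[i [j [i2 _ o]]] := sq.
by exists i; have [iE|<-] := only_ends _ _ o; first lia.
Qed.

(** If [s] fails to straddle [t], then the two maximal windows and their common
    part join any two vertices, by a path with at most four edges. The gap of 3
    between the sizes makes the common part larger than [s], hence a vertex as
    soon as it contains [s]. *)
Lemma disconnected_straddles (s t : cperm) :
  3 <= size t - size s -> interval_disconnected s t -> straddles s t.
Proof.
move=> zst [u [v]]; rewrite !vertex_order_complex => -[uI vI no_path].
have s0 := cperm_size_gt0 s.
have po : occurs_at (window t 1 (size t).-1) t 1 (size t).-1.
  by apply: occurs_at_window; lia.
have qo : occurs_at (window t 2 (size t)) t 2 (size t).
  by apply: occurs_at_window; lia.
have ro : occurs_at (window t 2 (size t).-1) t 2 (size t).-1.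
  by apply: occurs_at_window; lia.
have zp := occurs_at_size po; have zq := occurs_at_size qo.
have zr := occurs_at_size ro.
set p := window t 1 _ in po zp; set q := window t 2 (size t) in qo zq.
set r := window t 2 _ in ro zr.
have [t2 zst1] : 2 < size t /\ size s < size t by lia.
have mem_I x i j : occurs_at x t i j -> size s < size x < size t ->
    (s <= x)%O -> x \in open_interval s t.
  move=> o /andP[sx xt] le_sx.
  by rewrite inE !cperm_ltE le_sx sx (occurs_at_le o).
have pI : (s <= p)%O -> p \in open_interval s t by apply: mem_I po _; lia.
have qI : (s <= q)%O -> q \in open_interval s t by apply: mem_I qo _; lia.
have rI : (s <= r)%O -> r \in open_interval s t by apply: mem_I ro _; lia.
have below x : x \in open_interval s t ->
    (s <= x)%O /\ ((x <= p)%O \/ (x <= q)%O).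
  case/andP=> /ltW sx xt; split=> //.
  by apply: lt_maximal_window => //; exact: ltnW.
have [su u_pq] := below u uI; have [sv v_pq] := below v vI.
have no_path_via c : c \in open_interval s t -> ~ ((u <= c)%O /\ (v <= c)%O).
  move=> cI [uc vc]; have := no_path [:: c; v].
  rewrite /= !edge_order_complex uI cI vI (le_comparable uc).
  by rewrite (ge_comparable vc) eqxx => /(_ isT).
(* If [s] is not below one maximal window, then both ends of the missing path
   lie below the other one. *)
have sp : (s <= p)%O.
  case: u_pq v_pq => [up|uq]; first by rewrite (le_trans su up).
  case=> [vp|vq]; first by rewrite (le_trans sv vp).
  by case: (no_path_via q) => //; apply: qI; exact: le_trans uq.
have sq : (s <= q)%O.
  case: u_pq v_pq => [up|uq]; last by rewrite (le_trans su uq).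
  case=> [vp|vq]; last by rewrite (le_trans sv vq).
  by case: (no_path_via p) => //; apply: pI.
have rp : (r <= p)%O.
  by apply/(le_occurs_atP _ po); exists 2, (size t).-1; split.
have rq : (r <= q)%O.
  by apply/(le_occurs_atP _ qo); exists 2, (size t).-1; rewrite leq_pred.
apply: straddles_from_windows => // sr.
have above x : x \in open_interval s t ->
    exists c, [/\ c \in open_interval s t, (x <= c)%O & (r <= c)%O].
  by move=> /below[_ [xp|xq]]; [exists p | exists q]; split=> //; auto.
have [c [cI uc rc]] := above u uI; have [e [eI ve re]] := above v vI.
have := no_path [:: c; r; e; v].
rewrite /= !edge_order_complex uI cI (rI sr) eI vI (le_comparable uc).
by rewrite (ge_comparable rc) (le_comparable re) (ge_comparable ve) eqxx
   => /(_ isT).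
Qed.

Theorem theorem3p2 (sigma tau : cperm) :
  (sigma <= tau)%O -> 3 <= size tau - size sigma ->
  interval_disconnected sigma tau <-> straddles sigma tau.
Proof.
move=> _ zst; split; first exact: disconnected_straddles.
by move=> st; apply: straddles_disconnected => //; exact: ltnW.
Qed.
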